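(* Let $0<l_2\le l_1$ be real numbers, and put $$c^*=\tfrac12\left(l_1+l_2+\sqrt{l_1^2+l_2^2-l_1l_2}\right),\quad a^*=\frac{c^*}{2c^*/l_1-1},\quad b^*=\frac{c^*}{2c^*/l_2-1},\quad m_c^*=\tfrac12(a^*-b^* ).$$ For any $x$ with $m_c^*<x<\infty$ there exists a unique triangle $ABC$ with $l_a=l_2$, $l_b=l_1$ and $m_c=x$. If $x\le m_c^*$, no such triangle exists.
   Context: For a non-degenerate triangle $ABC$ in the Euclidean plane, $l_a$ and $l_b$ denote the lengths of the internal angle bisectors drawn from $A$ and $B$ respectively, measured from the vertex to the opposite side; $m_c$ is the length of the median from $C$ to the midpoint of $AB$. Uniqueness of triangles is understood up to congruence respecting the vertex labels. *)

(* Defs.v *)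
From Stdlib Require Import Reals.
Local Open Scope R_scope.

Definition point : Type := (R * R)%type.

Definition pdist (P Q : point) : R := dist_euc (fst P) (snd P) (fst Q) (snd Q).

Definition midpoint (P Q : point) : point :=
  ((fst P + fst Q) / 2, (snd P + snd Q) / 2).

Definition on_segment (P Q D : point) : Prop :=
  exists t : R, 0 <= t <= 1 /\
    D = (fst P + t * (fst Q - fst P), snd P + t * (snd Q - snd P)).

(* Unoriented angle PVQ, in [0, PI]; only meaningful when P <> V and Q <> V. *)
Definition angle (P V Q : point) : R :=
  acos (((fst P - fst V) * (fst Q - fst V) + (snd P - snd V) * (snd Q - snd V))
        / (pdist V P * pdist V Q)).

Definition collinear (P Q S : point) : Prop :=
  (fst Q - fst P) * (snd S - snd P) - (snd Q - snd P) * (fst S - fst P) = 0.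

Record plane_triangle : Type := PlaneTriangle {
  vA : point;
  vB : point;
  vC : point;
  nondegenerate : ~ collinear vA vB vC
}.

(* The internal bisector of the angle at V in the triangle V P Q, taken from V
   to the point D where it meets the opposite side, has length l.
   For V, P, Q not collinear such a D exists and is unique, so that l is
   determined by V, P, Q. *)
Definition bisector_length (V P Q : point) (l : R) : Prop :=
  exists D : point,
    on_segment P Q D /\ angle P V D = angle D V Q /\ pdist V D = l.

Definition has_l_a (T : plane_triangle) (l : R) : Prop :=
  bisector_length (vA T) (vB T) (vC T) l.

Definition has_l_b (T : plane_triangle) (l : R) : Prop :=
  bisector_length (vB T) (vC T) (vA T) l.

Definition m_c (T : plane_triangle) : R := pdist (vC T) (midpoint (vA T) (vB T)).

Definition isometry (f : point -> point) : Prop :=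
  forall P Q : point, pdist (f P) (f Q) = pdist P Q.

(* Orientation-reversing isometries are allowed. *)
Definition congruent (T T' : plane_triangle) : Prop :=
  exists f : point -> point,
    isometry f /\ f (vA T) = vA T' /\ f (vB T) = vB T' /\ f (vC T) = vC T'.

(* Main.v *)
Require Import Defs.
From Stdlib Require Import Reals Lra Psatz.
From Coquelicot Require Import Coquelicot.

(** For sides [a], [b], [c] put [u = (a + b) / c > 1] and [v = (a - b) / c] in [(-1, 1)]. The two bisector
    conditions fix [c] as a function of [(u, v)] and leave one equation [ratio_defect = 0], strictly increasing
    in [v]; its zero set is a curve [v = v u], [u >= 1]. Along this curve [8 m_c^2 / l1^2 = median_ratio u v]
    has positive derivative: by implicit differentiation this is the positivity of a Jacobian, which becomes
    visible when its numerator is expanded in [u - 1] and [1 - v^2]. So [m_c] increases from its value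
    at [u = 1], the degenerate triangle with C on AB, to infinity, and determines [(u, v)] and then [c]. *)
Local Open Scope R_scope.

(** * Triangles, bisectors and congruence *)

Lemma pdist_ge0 (P Q : point) : 0 <= pdist P Q.
Proof. apply sqrt_pos. Qed.

Lemma pdist_sqr (P Q : point) :
  pdist P Q ^ 2 = (fst P - fst Q) ^ 2 + (snd P - snd Q) ^ 2.
Proof.
unfold pdist, dist_euc.
rewrite pow2_sqrt by (apply Rplus_le_le_0_compat; apply Rle_0_sqr).
unfold Rsqr; ring.
Qed.

Lemma pdist_sym (P Q : point) : pdist P Q = pdist Q P.
Proof. apply distance_symm. Qed.

Lemma pow2_inj (x y : R) : 0 <= x -> 0 <= y -> x ^ 2 = y ^ 2 -> x = y.
Proof. intros; nra. Qed.

Lemma pow2_gt0 (x : R) : x <> 0 -> 0 < x ^ 2.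
Proof. intros; nra. Qed.

Lemma pdist_gt0 (P Q : point) :
  fst P <> fst Q \/ snd P <> snd Q -> 0 < pdist P Q.
Proof.
intros H.
assert (H2 := pdist_sqr P Q).
assert (H0 := pdist_ge0 P Q).
assert (0 < (fst P - fst Q) ^ 2 + (snd P - snd Q) ^ 2).
{ assert (h := pow2_ge_0 (fst P - fst Q)). assert (h' := pow2_ge_0 (snd P - snd Q)).
  destruct H as [H|H]; apply Rminus_eq_contra, pow2_gt0 in H; lra. }
destruct H0 as [H0|H0]; [exact H0|].
rewrite <- H0 in H2. lra.
Qed.

Lemma noncollinear_gt0 (P Q S : point) :
  ~ collinear P Q S -> 0 < pdist P Q /\ 0 < pdist P S /\ 0 < pdist Q S.
Proof.
unfold collinear; intros H.
repeat split; apply pdist_gt0;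
  match goal with |- ?a <> ?b \/ ?c <> ?d =>
    destruct (Req_dec a b) as [e|e]; [right|left; exact e];
    intros e'; apply H; nra end.
Qed.

Lemma noncollinear_rotate (P Q S : point) : ~ collinear P Q S -> ~ collinear Q S P.
Proof. unfold collinear; intros H H'; apply H; lra. Qed.

(** By Lagrange's identity the squared determinant is [p^2 q^2] minus the squared scalar product. It
    is positive here, so the scalar product exceeds [- (p q)], and the law of cosines gives
    [a^2 < (p + q)^2]. *)
Lemma triangle_ineq_strict (P Q S : point) :
  ~ collinear P Q S -> pdist Q S < pdist P Q + pdist P S.
Proof.
intros H.
destruct (noncollinear_gt0 _ _ _ H) as (h1 & h2 & h3).
assert (e1 := pdist_sqr P Q). assert (e2 := pdist_sqr P S). assert (e3 := pdist_sqr Q S).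
set (p := pdist P Q) in *. set (q := pdist P S) in *. set (a := pdist Q S) in *.
destruct P as [x y], Q as [x1 y1], S as [x2 y2]; unfold collinear in H; simpl fst in *; simpl snd in *.
set (X := x1 - x) in *. set (Y := y1 - y) in *. set (Z := x2 - x) in *. set (W := y2 - y) in *.
assert (hd : 0 < (X * W - Y * Z) ^ 2) by (apply pow2_gt0; exact H).
assert (f1 : p ^ 2 = X ^ 2 + Y ^ 2) by (rewrite e1; unfold X, Y; ring).
assert (f2 : q ^ 2 = Z ^ 2 + W ^ 2) by (rewrite e2; unfold Z, W; ring).
assert (f3 : a ^ 2 = p ^ 2 + q ^ 2 - 2 * (X * Z + Y * W))
  by (rewrite e3, f1, f2; unfold X, Y, Z, W; ring).
assert (g : (X * Z + Y * W) ^ 2 < (p * q) ^ 2).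
{ replace ((p * q) ^ 2) with (p ^ 2 * q ^ 2) by ring. rewrite f1, f2. nra. }
assert (pq : 0 < p * q) by (apply Rmult_lt_0_compat; assumption).
assert (- (p * q) < X * Z + Y * W) by nra.
nra.
Qed.

(** Cauchy-Schwarz; it puts the argument of [acos] in the range where [cos] inverts it, so that
    equal angles can be compared by their cosines. *)
Lemma cos_angle_bound (x y z w p q : R) :
  0 < p -> 0 < q -> p ^ 2 = x ^ 2 + y ^ 2 -> q ^ 2 = z ^ 2 + w ^ 2 ->
  -1 <= (x * z + y * w) / (p * q) <= 1.
Proof.
intros hp hq e1 e2.
assert (pq : 0 < p * q) by (apply Rmult_lt_0_compat; assumption).
assert (g : (x * z + y * w) ^ 2 <= (p * q) ^ 2).
{ replace ((p * q) ^ 2) with (p ^ 2 * q ^ 2) by ring. rewrite e1, e2.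
  assert (0 <= (x * w - y * z) ^ 2) by apply pow2_ge_0. nra. }
assert (- (p * q) <= x * z + y * w <= p * q) by (split; nra).
split.
- apply (Rmult_le_reg_r (p * q)); [exact pq|].
  unfold Rdiv; rewrite Rmult_assoc, Rinv_l; lra.
- apply (Rmult_le_reg_r (p * q)); [exact pq|].
  unfold Rdiv; rewrite Rmult_assoc, Rinv_l; lra.
Qed.

Lemma angle_eq_cos (P V Q P' Q' : point) :
  0 < pdist V P -> 0 < pdist V Q -> 0 < pdist V P' -> 0 < pdist V Q' ->
  angle P V Q = angle P' V Q' <->
  ((fst P - fst V) * (fst Q - fst V) + (snd P - snd V) * (snd Q - snd V))
    / (pdist V P * pdist V Q) =
  ((fst P' - fst V) * (fst Q' - fst V) + (snd P' - snd V) * (snd Q' - snd V))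
    / (pdist V P' * pdist V Q').
Proof.
intros h1 h2 h3 h4; split.
- unfold angle; intros e; apply (f_equal cos) in e.
  rewrite !cos_acos in e; [exact e| |];
  (apply cos_angle_bound; [assumption|assumption| |]; rewrite pdist_sqr; ring).
- unfold angle; intros e; rewrite e; reflexivity.
Qed.

(** With [g] the scalar product of the vectors from [V] to [P] and to [Q], the difference of the two
    cosines is [(1 - t) p - t q] times [(p q - g) / (p q d)]. The second factor is positive because
    non-collinearity makes Cauchy-Schwarz strict. *)
Lemma bisector_foot (V P Q : point) (t : R) :
  ~ collinear V P Q ->
  let D := (fst P + t * (fst Q - fst P), snd P + t * (snd Q - snd P)) in
  angle P V D = angle D V Q <-> (1 - t) * pdist V P = t * pdist V Q.
Proof.
intros H D.
destruct (noncollinear_gt0 _ _ _ H) as (hp & hq & _).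
assert (hd : 0 < pdist V D).
{ apply pdist_gt0.
  destruct (Req_dec (fst V) (fst D)) as [e|e]; [right|left; exact e].
  intros e'; apply H. unfold D in e, e'; simpl in e, e'. unfold collinear.
  rewrite e, e'. ring. }
rewrite angle_eq_cos by assumption.
assert (e1 := pdist_sqr V P). assert (e2 := pdist_sqr V Q).
set (p := pdist V P) in *. set (q := pdist V Q) in *. set (d := pdist V D) in *.
clearbody d. clearbody p q.
unfold D; simpl.
destruct P as [x y], Q as [z w], V as [m n]; unfold collinear in H; simpl in *.
set (g := (x - m) * (z - m) + (y - n) * (w - n)).
assert (hg : g < p * q).
{ assert (pq : 0 < p * q) by (apply Rmult_lt_0_compat; assumption).
  assert (0 < ((x - m) * (w - n) - (y - n) * (z - m)) ^ 2) by (apply pow2_gt0; exact H).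
  assert (g ^ 2 < (p * q) ^ 2).
  { replace ((p * q) ^ 2) with ((p * (p * 1)) * (q * (q * 1))) by ring. rewrite e1, e2. unfold g. nra. }
  nra. }
replace ((x - m) * (x + t * (z - x) - m) + (y - n) * (y + t * (w - y) - n))
  with ((1 - t) * p ^ 2 + t * g)
  by (replace (p ^ 2) with (p * (p * 1)) by ring; rewrite e1; unfold g; ring).
replace ((x + t * (z - x) - m) * (z - m) + (y + t * (w - y) - n) * (w - n))
  with ((1 - t) * g + t * q ^ 2)
  by (replace (q ^ 2) with (q * (q * 1)) by ring; rewrite e2; unfold g; ring).
assert (key : ((1 - t) * p ^ 2 + t * g) / (p * d) - ((1 - t) * g + t * q ^ 2) / (d * q)
   = ((1 - t) * p - t * q) * ((p * q - g) / (p * q * d))) by (field; lra).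
assert (0 < (p * q - g) / (p * q * d)).
{ apply Rdiv_lt_0_compat; [lra|]. repeat apply Rmult_lt_0_compat; assumption. }
split; intros e.
- assert (((1 - t) * p - t * q) * ((p * q - g) / (p * q * d)) = 0) by lra.
  nra.
- assert (((1 - t) * p - t * q) * ((p * q - g) / (p * q * d)) = 0) by nra.
  lra.
Qed.

(** Eliminates the foot of the bisector: the angle condition forces [t = p / (p + q)], which turns
    the length into the classical formula, here with denominators cleared. *)
Lemma bisector_lengthP (V P Q : point) (l : R) :
  ~ collinear V P Q ->
  let p := pdist V P in let q := pdist V Q in
  bisector_length V P Q l <->
  0 <= l /\ l ^ 2 * (p + q) ^ 2 = p * q * ((p + q) ^ 2 - pdist P Q ^ 2).
Proof.
intros H p q.
destruct (noncollinear_gt0 _ _ _ H) as (hp & hq & _).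
fold p q in hp, hq.
pose (foot := fun t => (fst P + t * (fst Q - fst P), snd P + t * (snd Q - snd P))).
(* Stewart's theorem *)
assert (len : forall t, (1 - t) * p = t * q ->
  pdist V (foot t) ^ 2 * (p + q) ^ 2 = p * q * ((p + q) ^ 2 - pdist P Q ^ 2)).
{ intros t et.
  assert (tE : t = p / (p + q)) by (field_simplify_eq; lra).
  assert (S : pdist V (foot t) ^ 2 =
     (1 - t) * p ^ 2 + t * q ^ 2 - t * (1 - t) * pdist P Q ^ 2).
  { unfold p, q; rewrite !pdist_sqr; unfold foot; simpl; ring. }
  rewrite S, tE. field. lra. }
split.
- intros (D & (t & ht & eD) & ang & <-).
  split; [apply pdist_ge0|].
  change (D = foot t) in eD; subst D.
  apply len, (bisector_foot V P Q t H), ang.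
- intros (hl & el).
  set (t := p / (p + q)).
  assert (et : (1 - t) * p = t * q) by (unfold t; field; lra).
  assert (ht : 0 <= t <= 1).
  { assert (0 < t) by (unfold t; apply Rdiv_lt_0_compat; lra). split; nra. }
  exists (foot t); split; [exists t; split; [exact ht|reflexivity]|].
  split; [apply (bisector_foot V P Q t H), et|].
  apply pow2_inj; [apply pdist_ge0|exact hl|].
  apply (Rmult_eq_reg_r ((p + q) ^ 2)); [|apply pow_nonzero; lra].
  rewrite el; apply len, et.
Qed.

Lemma m_c_sqr (T : plane_triangle) :
  4 * m_c T ^ 2 =
  2 * pdist (vB T) (vC T) ^ 2 + 2 * pdist (vC T) (vA T) ^ 2 - pdist (vA T) (vB T) ^ 2.
Proof. unfold m_c; rewrite !pdist_sqr; simpl; field. Qed.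

(** The isometry is the affine map between the two triangles, written in the coordinates [s], [t] of
    the frame [AB], [AC] by Cramer's rule; [d] is twice the signed area of the source. *)
Lemma congruent_sss (T T' : plane_triangle) :
  pdist (vA T) (vB T) = pdist (vA T') (vB T') ->
  pdist (vB T) (vC T) = pdist (vB T') (vC T') ->
  pdist (vC T) (vA T) = pdist (vC T') (vA T') -> congruent T T'.
Proof.
destruct T as [[ax ay] [bx by_] [cx cy] nd], T' as [[ax' ay'] [bx' by'] [cx' cy'] nd'].
unfold congruent; simpl vA; simpl vB; simpl vC.
intros ec ea eb.
apply (f_equal (fun r => r ^ 2)) in ec, ea, eb.
rewrite !pdist_sqr in ec, ea, eb; simpl fst in *; simpl snd in *.
unfold collinear in nd; simpl in nd; clear nd'.
set (d := (bx - ax) * (cy - ay) - (by_ - ay) * (cx - ax)) in nd.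
set (f := fun P : point =>
  let s := ((fst P - ax) * (cy - ay) - (snd P - ay) * (cx - ax)) / d in
  let t := ((bx - ax) * (snd P - ay) - (by_ - ay) * (fst P - ax)) / d in
  (ax' + s * (bx' - ax') + t * (cx' - ax'), ay' + s * (by' - ay') + t * (cy' - ay'))).
exists f; split; [|repeat split].
- intros [px py] [qx qy].
  apply pow2_inj; try apply pdist_ge0.
  rewrite !pdist_sqr; unfold f; simpl fst; simpl snd.
  set (s := ((px - qx) * (cy - ay) - (py - qy) * (cx - ax)) / d).
  set (t := ((bx - ax) * (py - qy) - (by_ - ay) * (px - qx)) / d).
  transitivity ((s * (bx' - ax') + t * (cx' - ax')) ^ 2 + (s * (by' - ay') + t * (cy' - ay')) ^ 2).
  { unfold s, t; field; exact nd. }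
  transitivity ((s * (bx - ax) + t * (cx - ax)) ^ 2 + (s * (by_ - ay) + t * (cy - ay)) ^ 2).
  (* The squared length of [s AB + t AC] is [(s^2 + s t) c^2 + (t^2 + s t) b^2 - s t a^2], so it
     depends only on the sides. *)
  { apply (f_equal (Rmult (s * s + s * t))) in ec.
    apply (f_equal (Rmult (t * t + s * t))) in eb.
    apply (f_equal (Rmult (s * t))) in ea.
    clearbody s t; lra. }
  replace (px - qx) with (s * (bx - ax) + t * (cx - ax))
   by (unfold s, t, d; field; exact nd).
  replace (py - qy) with (s * (by_ - ay) + t * (cy - ay))
   by (unfold s, t, d; field; exact nd).
  reflexivity.
- unfold f; simpl; f_equal; field; exact nd.
- unfold f; simpl; f_equal; unfold d; field; exact nd.
- unfold f; simpl; f_equal; unfold d; field; exact nd.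
Qed.

Lemma triangle_of_sides (a b c : R) :
  0 < c -> c < a + b -> a < b + c -> b < a + c ->
  exists T : plane_triangle,
    pdist (vA T) (vB T) = c /\ pdist (vB T) (vC T) = a /\ pdist (vC T) (vA T) = b.
Proof.
intros hc h1 h2 h3.
(* With A at the origin and B at [(c, 0)], the law of cosines gives this abscissa of C; positivity
   of the squared ordinate is Heron's formula. *)
set (x := (b ^ 2 + c ^ 2 - a ^ 2) / (2 * c)).
assert (hx : 0 < b ^ 2 - x ^ 2).
{ replace (b ^ 2 - x ^ 2)
   with ((a + b + c) * (a + b - c) * (a + c - b) * (b + c - a) / (4 * c ^ 2))
   by (unfold x; field; lra).
  apply Rdiv_lt_0_compat; [repeat apply Rmult_lt_0_compat; lra|nra]. }
set (y := sqrt (b ^ 2 - x ^ 2)).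
assert (hy : 0 < y) by (apply sqrt_lt_R0; exact hx).
assert (ey : y ^ 2 = b ^ 2 - x ^ 2) by (apply pow2_sqrt; lra).
assert (nd : ~ collinear (0, 0) (c, 0) (x, y)).
{ unfold collinear; simpl; nra. }
exists (PlaneTriangle _ _ _ nd); simpl.
repeat split; apply pow2_inj; try apply pdist_ge0; try lra; rewrite pdist_sqr; simpl fst; simpl snd.
- ring.
- replace ((c - x) ^ 2 + (0 - y) ^ 2) with (c ^ 2 - 2 * c * x + x ^ 2 + y ^ 2) by ring.
  rewrite ey; unfold x; field; lra.
- replace ((x - 0) ^ 2 + (y - 0) ^ 2) with (x ^ 2 + y ^ 2) by ring.
  rewrite ey; ring.
Qed.

(** * The curve of triangles with a given ratio of bisectors *)

(** Pick [x < v u0 < y]. The signs [F u0 x < 0 < F u0 y] persist for nearby [u] by continuity in [u]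
    alone, and monotonicity then traps [v u] between [x] and [y]. *)
Lemma implicit_continuous (F : R -> R -> R) (v : R -> R) (a b u0 : R) :
  (forall u x y, a < x -> x < y -> y < b -> F u x < F u y) ->
  (forall x, continuous (fun u => F u x) u0) ->
  (forall u, a < v u < b /\ F u (v u) = 0) ->
  continuous v u0.
Proof.
intros incr cont root.
apply filterlim_locally; intros eps.
destruct (root u0) as [hv0 e0].
(* The midpoints keep [x] and [y] inside the interval where [F] is increasing. *)
set (x := Rmax (v u0 - eps) ((a + v u0) / 2)).
set (y := Rmin (v u0 + eps) ((v u0 + b) / 2)).
assert (he := cond_pos eps).
assert (hx : a < x < v u0 /\ v u0 - eps <= x)
  by (unfold x, Rmax; destruct (Rle_dec _ _); lra).
assert (hy : v u0 < y < b /\ y <= v u0 + eps)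
  by (unfold y, Rmin; destruct (Rle_dec _ _); lra).
assert (fx : F u0 x < 0) by (rewrite <- e0; apply incr; lra).
assert (fy : 0 < F u0 y) by (rewrite <- e0; apply incr; lra).
assert (nx : locally u0 (fun u => F u x < 0)) by exact (cont x _ (open_lt 0 _ fx)).
assert (ny : locally u0 (fun u => 0 < F u y)) by exact (cont y _ (open_gt 0 _ fy)).
generalize (filter_and _ _ nx ny).
apply filter_imp; intros u [gx gy].
destruct (root u) as [hv e].
assert (x < v u).
{ destruct (Rlt_le_dec x (v u)) as [h|h]; [exact h|].
  destruct h as [h|h]; [|rewrite h in e; lra].
  assert (F u (v u) < F u x) by (apply incr; lra). lra. }
assert (v u < y).
{ destruct (Rlt_le_dec (v u) y) as [h|h]; [exact h|].
  destruct h as [h|h]; [|rewrite <- h in e; lra].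
  assert (F u y < F u (v u)) by (apply incr; lra). lra. }
apply Rabs_def1; unfold minus, plus, opp; simpl; lra.
Qed.

(** Carathéodory's form of the derivative: a slope function continuous at [x]. It yields the
    derivative of the implicit curve from exact difference quotients. *)
Lemma is_derive_caratheodory (f phi : R -> R) (x : R) :
  locally x (fun y => f y - f x = (y - x) * phi y) -> continuous phi x ->
  is_derive f x (phi x).
Proof.
intros [d hd] cphi.
apply is_derive_Reals; intros eps heps.
destruct (proj1 (filterlim_locally _ _) cphi (mkposreal eps heps)) as [d' hd'].
assert (hm : 0 < Rmin d d') by (apply Rmin_pos; apply cond_pos).
exists (mkposreal _ hm); intros h hn hh; simpl in hh.
assert (b1 : Rabs h < d) by (eapply Rlt_le_trans; [exact hh|apply Rmin_l]).
assert (b2 : Rabs h < d') by (eapply Rlt_le_trans; [exact hh|apply Rmin_r]).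
assert (E : x + h + - x = h) by ring.
rewrite hd.
- replace ((x + h - x) * phi (x + h) / h) with (phi (x + h)) by (field; exact hn).
  apply hd'; change (Rabs (x + h + - x) < d'); rewrite E; exact b2.
- change (Rabs (x + h + - x) < d); rewrite E; exact b1.
Qed.

(* In the coordinates [u], [v], the ratio [(l_b / l_a) ^ 2] is [bis u v / bis u (- v)]. *)
Definition bis (u v : R) : R := (u + v) * (1 + v) * (u + 2 - v) ^ 2.

(* [bis_du] and [bis_dv] are difference quotients of [bis], used where [v] is not yet known to be differentiable. *)
Definition bis_du (u u' v : R) : R :=
  (1 + v) * ((u + 2 - v) ^ 2 + (u' + v) * (u + u' + 4 - 2 * v)).

Definition bis_dv (u v w : R) : R :=
  (1 + v) * (u + 2 - v) ^ 2 + (u + w) * (u + 2 - v) ^ 2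
  - (u + w) * (1 + w) * (2 * (u + 2) - v - w).

Lemma bis_duE (u u' v : R) : bis u v - bis u' v = (u - u') * bis_du u u' v.
Proof. unfold bis, bis_du; ring. Qed.

Lemma bis_dvE (u v w : R) : bis u v - bis u w = (v - w) * bis_dv u v w.
Proof. unfold bis, bis_dv; ring. Qed.

(** The quotient is symmetric in [v] and [w], so take [w <= v]. The subtracted term splits along
    [(u + 2 - w) + (u + 2 - v)], and each half is bounded by one of the two positive terms. *)
Lemma bis_dv_gt0 (u v w : R) :
  1 <= u -> -1 < v < 1 -> -1 < w < 1 -> 0 < bis_dv u v w.
Proof.
assert (main : forall v w, 1 <= u -> -1 < v < 1 -> -1 < w < 1 -> w <= v -> 0 < bis_dv u v w).
{ clear v w; intros v w hu hv hw hvw.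
  (* The left side is [(u + 1)^2 - (1 - w)^2]. *)
  assert (h1 : (u + w) * (u + 2 - w) < (u + 2 - v) ^ 2).
  { assert (0 < (1 - w) ^ 2) by nra. assert ((u + 1) ^ 2 < (u + 2 - v) ^ 2) by nra. lra. }
  assert (h2 : (1 + w) * ((u + w) * (u + 2 - w)) < (1 + v) * (u + 2 - v) ^ 2).
  { apply Rlt_le_trans with ((1 + w) * (u + 2 - v) ^ 2).
    - apply Rmult_lt_compat_l; lra.
    - apply Rmult_le_compat_r; [apply pow2_ge_0|lra]. }
  assert (h3 : (u + w) * (1 + w) * (u + 2 - v) <= (u + w) * (u + 2 - v) ^ 2).
  { replace ((u + w) * (u + 2 - v) ^ 2) with ((u + w) * (u + 2 - v) * (u + 2 - v)) by ring.
    replace ((u + w) * (1 + w) * (u + 2 - v)) with ((u + w) * (u + 2 - v) * (1 + w)) by ring.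
    apply Rmult_le_compat_l; [|lra].
    apply Rmult_le_pos; lra. }
  unfold bis_dv; lra. }
intros hu hv hw.
destruct (Rle_dec w v) as [h|h]; [apply main; assumption|].
replace (bis_dv u v w) with (bis_dv u w v) by (unfold bis_dv; ring).
apply main; lra.
Qed.

(** Cross-multiplied form of [bis u v / bis u (- v) = p / q], used with [p = l1^2] and [q = l2^2];
    it stays polynomial up to [v = -1] and [v = 1]. *)
Definition ratio_defect (p q u v : R) : R := q * bis u v - p * bis u (- v).

Lemma ratio_defect_incr (p q u v w : R) :
  0 < p -> 0 < q -> 1 <= u -> -1 < v -> v < w -> w < 1 ->
  ratio_defect p q u v < ratio_defect p q u w.
Proof.
intros hp hq hu hv hvw hw; unfold ratio_defect.
assert (h1 := bis_dvE u w v). assert (h2 := bis_dvE u (- v) (- w)).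
assert (g1 : 0 < bis_dv u w v) by (apply bis_dv_gt0; lra).
assert (g2 : 0 < bis_dv u (- v) (- w)) by (apply bis_dv_gt0; lra).
assert (0 < bis u w - bis u v) by (rewrite h1; apply Rmult_lt_0_compat; lra).
assert (0 < bis u (- v) - bis u (- w)) by (rewrite h2; apply Rmult_lt_0_compat; lra).
nra.
Qed.

Lemma ratio_defect_root_unique (p q u v w : R) :
  0 < p -> 0 < q -> 1 <= u -> -1 < v < 1 -> -1 < w < 1 ->
  ratio_defect p q u v = 0 -> ratio_defect p q u w = 0 -> v = w.
Proof.
intros hp hq hu hv hw ev ew.
destruct (Rtotal_order v w) as [h|[h|h]]; [|exact h|].
- assert (ratio_defect p q u v < ratio_defect p q u w) by (apply ratio_defect_incr; lra). lra.
- assert (ratio_defect p q u w < ratio_defect p q u v) by (apply ratio_defect_incr; lra). lra.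
Qed.

(** At each end of [[-1, 1]] one of the two [bis] terms vanishes, which gives opposite signs. The
    result is informative so that the roots can be collected into a function of [u]. *)
Lemma ratio_defect_root (p q u : R) :
  0 < p -> 0 < q -> 1 <= u -> {v : R | -1 < v < 1 /\ ratio_defect p q u v = 0}.
Proof.
intros hp hq hu.
assert (em : ratio_defect p q u (-1) = - (2 * p * (u + 1) ^ 3))
  by (unfold ratio_defect, bis; ring).
assert (ep : ratio_defect p q u 1 = 2 * q * (u + 1) ^ 3)
  by (unfold ratio_defect, bis; ring).
assert (h3 : 0 < (u + 1) ^ 3) by (apply pow_lt; lra).
assert (lm : ratio_defect p q u (-1) < 0).
{ rewrite em. assert (0 < 2 * p * (u + 1) ^ 3) by (apply Rmult_lt_0_compat; lra). lra. }
assert (lp : 0 < ratio_defect p q u 1).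
{ rewrite ep. apply Rmult_lt_0_compat; lra. }
destruct (IVT (ratio_defect p q u) (-1) 1) as [v [hv ev]]; [|lra|exact lm|exact lp|].
- unfold ratio_defect, bis; reg.
- exists v; split; [|exact ev].
  split.
  + destruct (Rle_lt_or_eq_dec _ _ (proj1 hv)) as [h|h]; [exact h|]. rewrite <- h in ev; lra.
  + destruct (Rle_lt_or_eq_dec _ _ (proj2 hv)) as [h|h]; [exact h|]. rewrite h in ev; lra.
Qed.

(* The value of [8 * m_c ^ 2 / l_b ^ 2]. *)
Definition median_ratio (u v : R) : R :=
  (u ^ 2 + v ^ 2 - 1) * (u + 2 + v) ^ 2 / ((u + v) * (1 + v) * (1 + u)).

(* The curve is extended by the constant [v 1] for [u < 1] so that it is continuous on all of R. *)
Definition ratio_curve (p q : R) (v : R -> R) : Prop :=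
  forall u, -1 < v u < 1 /\ ratio_defect p q (Rmax 1 u) (v u) = 0.

Lemma ratio_curve_exists (p q : R) :
  0 < p -> 0 < q -> exists v : R -> R, ratio_curve p q v.
Proof.
intros hp hq.
exists (fun u => proj1_sig (ratio_defect_root p q (Rmax 1 u) hp hq (Rmax_l 1 u))).
intros u; exact (proj2_sig (ratio_defect_root p q (Rmax 1 u) hp hq (Rmax_l 1 u))).
Qed.

Lemma continuous_Rmax (x u : R) : continuous (Rmax x) u.
Proof.
apply continuous_ext with (fun y => (x + y + Rabs (x - y)) / 2).
{ intros y; unfold Rmax, Rabs; destruct (Rle_dec x y), (Rcase_abs (x - y)); lra. }
apply continuity_pt_filterlim; reg.
Qed.

Lemma ratio_curve_continuous (p q : R) (v : R -> R) (u : R) :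
  0 < p -> 0 < q -> ratio_curve p q v -> continuous v u.
Proof.
intros hp hq hv.
apply (implicit_continuous (fun u x => ratio_defect p q (Rmax 1 u) x) v (-1) 1); [| |exact hv].
- intros w x y hx hxy hy; apply ratio_defect_incr; try assumption; apply Rmax_l.
- intros x.
  apply (continuous_comp (Rmax 1) (fun w => ratio_defect p q w x)); [apply continuous_Rmax|].
  apply continuity_pt_filterlim; unfold ratio_defect, bis; reg.
Qed.

(** The partial derivatives of [ln (bis u v)]; in logarithmic form [p] and [q] drop out along the
    curve. *)
Definition bis_log_du (u v : R) : R := / (u + v) + 2 / (u + 2 - v).
Definition bis_log_dv (u v : R) : R := / (u + v) + / (1 + v) - 2 / (u + 2 - v).

(** Subtracting the curve equations at [w] and [u] gives [(w - u) A w + (v w - v u) B w = 0] with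
    [B > 0]. So [- A / B] is a slope function, continuous at [u] because [v] is. *)
Lemma ratio_curve_derive (p q : R) (v : R -> R) (u : R) :
  0 < p -> 0 < q -> ratio_curve p q v -> 1 < u ->
  is_derive v u
    (- (bis_log_du u (v u) - bis_log_du u (- v u)) / (bis_log_dv u (v u) + bis_log_dv u (- v u))).
Proof.
intros hp hq hv hu.
set (A := fun w => q * bis_du w u (v w) - p * bis_du w u (- v w)).
set (B := fun w => q * bis_dv u (v w) (v u) + p * bis_dv u (- v w) (- v u)).
assert (Bpos : forall w, 0 < B w).
{ intros w; destruct (hv w) as [hw _]; destruct (hv u) as [h _].
  assert (0 < bis_dv u (v w) (v u)) by (apply bis_dv_gt0; lra).
  assert (0 < bis_dv u (- v w) (- v u)) by (apply bis_dv_gt0; lra).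
  unfold B; apply Rplus_lt_0_compat; apply Rmult_lt_0_compat; assumption. }
assert (rootE : forall w, 1 < w -> ratio_defect p q w (v w) = 0).
{ intros w hw; destruct (hv w) as [_ e]; rewrite Rmax_right in e; lra. }
destruct (hv u) as [hvu _].
assert (eu := rootE u hu).
assert (cv := ratio_curve_continuous p q v u hp hq hv).
assert (cv' : continuity_pt v u) by (apply continuity_pt_filterlim; exact cv).
replace (- (bis_log_du u (v u) - bis_log_du u (- v u)) / (bis_log_dv u (v u) + bis_log_dv u (- v u)))
  with (- A u / B u).
(* On the curve [q * bis u (v u) = p * bis u (- v u)]; this common factor cancels from [A u / B u]
   and leaves logarithmic derivatives. *)
2:{ assert (hX : 0 < bis u (v u)).
    { unfold bis; apply Rmult_lt_0_compat; [apply Rmult_lt_0_compat; lra|apply pow_lt; lra]. }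
    assert (EA : A u = q * bis u (v u) * (bis_log_du u (v u) - bis_log_du u (- v u))).
    { transitivity (q * bis u (v u) * bis_log_du u (v u) - p * bis u (- v u) * bis_log_du u (- v u)).
      - unfold A, bis_du, bis, bis_log_du; field; lra.
      - unfold ratio_defect in eu. replace (p * bis u (- v u)) with (q * bis u (v u)) by lra. ring. }
    assert (EB : B u = q * bis u (v u) * (bis_log_dv u (v u) + bis_log_dv u (- v u))).
    { transitivity (q * bis u (v u) * bis_log_dv u (v u) + p * bis u (- v u) * bis_log_dv u (- v u)).
      - unfold B, bis_dv, bis, bis_log_dv; field; lra.
      - unfold ratio_defect in eu. replace (p * bis u (- v u)) with (q * bis u (v u)) by lra. ring. }
    assert (hB := Bpos u).
    assert (bis_log_dv u (v u) + bis_log_dv u (- v u) <> 0).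
    { intros e; rewrite EB, e in hB; lra. }
    rewrite EA, EB; field; repeat split; lra. }
apply (is_derive_caratheodory v (fun w => - A w / B w)).
- generalize (open_gt 1 u hu); apply filter_imp; intros w hw.
  assert (ew := rootE w hw). assert (hB := Bpos w).
  assert (key : (v w - v u) * B w = - (w - u) * A w).
  { unfold ratio_defect in ew, eu.
    assert (h1 := bis_duE w u (v w)). assert (h2 := bis_duE w u (- v w)).
    assert (h3 := bis_dvE u (v w) (v u)). assert (h4 := bis_dvE u (- v w) (- v u)).
    unfold A, B.
    replace ((v w - v u) * (q * bis_dv u (v w) (v u) + p * bis_dv u (- v w) (- v u)))
      with (q * ((v w - v u) * bis_dv u (v w) (v u))
        - p * ((- v w - - v u) * bis_dv u (- v w) (- v u))) by ring.
    rewrite <- h3, <- h4.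
    replace (- (w - u) * (q * bis_du w u (v w) - p * bis_du w u (- v w)))
      with (- (q * ((w - u) * bis_du w u (v w))) + p * ((w - u) * bis_du w u (- v w))) by ring.
    rewrite <- h1, <- h2. lra. }
  apply (Rmult_eq_reg_r (B w)); [|lra].
  rewrite key; field; lra.
- apply continuity_pt_filterlim.
  assert (hB := Bpos u).
  unfold A, B, bis_du, bis_dv in *; reg; try exact cv'. lra.
Qed.

(** * Growth of the median along the curve *)

(** The partial derivatives of [ln (median_ratio u v)]. *)
Definition median_log_du (u v : R) : R :=
  2 * u / (u ^ 2 + v ^ 2 - 1) + 2 / (u + 2 + v) - / (u + v) - / (1 + u).
Definition median_log_dv (u v : R) : R :=
  2 * v / (u ^ 2 + v ^ 2 - 1) + 2 / (u + 2 + v) - / (u + v) - / (1 + v).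

Lemma bis_log_dv_gt0 (u v : R) : 1 <= u -> -1 < v < 1 -> 0 < bis_log_dv u v.
Proof.
intros hu hv; unfold bis_log_dv.
replace (/ (u + v) + / (1 + v) - 2 / (u + 2 - v))
  with (((u + 2 - v) * (1 + v) + (u + v) * (u + 2 - v) - 2 * (u + v) * (1 + v))
    / ((u + v) * (1 + v) * (u + 2 - v))) by (field; lra).
apply Rdiv_lt_0_compat; [|repeat apply Rmult_lt_0_compat; lra].
(* The numerator is the sum of this product and the next one. *)
assert (0 < (1 + v) * (2 - 2 * v)) by (apply Rmult_lt_0_compat; lra).
assert (0 <= (u + v) * (u + 1 - 2 * v)) by (apply Rmult_le_pos; lra).
lra.
Qed.

(* The sign of the derivative of [median_ratio] along the curve, where [v' = - g_u / g_v] for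
   [g = ln (bis u v) - ln (bis u (- v))]. *)
Lemma jacobian_gt0 (u v : R) :
  1 < u -> -1 < v < 1 ->
  0 < median_log_du u v * (bis_log_dv u v + bis_log_dv u (- v))
      - median_log_dv u v * (bis_log_du u v - bis_log_du u (- v)).
Proof.
intros hu hv.
set (s := u - 1). set (z := 1 - v ^ 2).
assert (hs : 0 < s) by (unfold s; lra).
assert (hz : 0 < z <= 1) by (unfold z; nra).
assert (hD : 0 < u ^ 2 + v ^ 2 - 1) by nra.
replace (median_log_du u v * (bis_log_dv u v + bis_log_dv u (- v))
      - median_log_dv u v * (bis_log_du u v - bis_log_du u (- v)))
 with (2 * (z * (72 - 24 * z) + s * (48 + 116 * z - 33 * z ^ 2 + z ^ 3)
    + s ^ 2 * (128 + 58 * z - 10 * z ^ 2) + s ^ 3 * (132 + 5 * z) + s ^ 4 * (68 - 4 * z)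
    + s ^ 5 * (18 - z) + 2 * s ^ 6)
   / ((u ^ 2 + v ^ 2 - 1) * ((u + 2 - v) * (u + 2 + v)) * ((u - v) * (u + v))
       * (1 + u) * ((1 - v) * (1 + v)))).
2:{ unfold median_log_du, median_log_dv, bis_log_dv, bis_log_du, s, z; field; lra. }
apply Rdiv_lt_0_compat; [|repeat apply Rmult_lt_0_compat; lra].
(* As a polynomial in [s], the numerator has only positive coefficients when [0 < z <= 1]. *)
assert (0 < z * (72 - 24 * z)) by (apply Rmult_lt_0_compat; lra).
assert (0 < s * (48 + 116 * z - 33 * z ^ 2 + z ^ 3)).
{ apply Rmult_lt_0_compat; [lra|]. assert (0 < z ^ 3) by (apply pow_lt; lra). nra. }
assert (0 < s ^ 2 * (128 + 58 * z - 10 * z ^ 2)).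
{ apply Rmult_lt_0_compat; [apply pow_lt; lra|nra]. }
assert (0 < s ^ 3 * (132 + 5 * z)) by (apply Rmult_lt_0_compat; [apply pow_lt; lra|lra]).
assert (0 < s ^ 4 * (68 - 4 * z)) by (apply Rmult_lt_0_compat; [apply pow_lt; lra|lra]).
assert (0 < s ^ 5 * (18 - z)) by (apply Rmult_lt_0_compat; [apply pow_lt; lra|lra]).
assert (0 < s ^ 6) by (apply pow_lt; lra).
lra.
Qed.

Lemma median_ratio_curve_continuous (p q : R) (v : R -> R) (u : R) :
  0 < p -> 0 < q -> ratio_curve p q v ->
  continuity_pt (fun w => median_ratio (Rmax 1 w) (v w)) u.
Proof.
intros hp hq hv.
assert (cv : continuity_pt v u)
  by (apply continuity_pt_filterlim, (ratio_curve_continuous p q); assumption).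
assert (cm : continuity_pt (Rmax 1) u)
  by (apply continuity_pt_filterlim, continuous_Rmax).
destruct (hv u) as [h _]; assert (hm := Rmax_l 1 u).
unfold median_ratio; reg; try assumption.
apply Rgt_not_eq; repeat apply Rmult_lt_0_compat; lra.
Qed.

(** The logarithmic derivative along the curve is the Jacobian of [jacobian_gt0] divided by a sum of
    two positive [bis_log_dv] terms. *)
Lemma median_ratio_curve_derive (p q : R) (v : R -> R) (u : R) :
  0 < p -> 0 < q -> ratio_curve p q v -> 1 < u ->
  exists d, 0 < d /\ is_derive (fun w => median_ratio (Rmax 1 w) (v w)) u d.
Proof.
intros hp hq hv hu.
assert (dv := ratio_curve_derive p q v u hp hq hv hu).
destruct (hv u) as [h _].
set (dvu := - (bis_log_du u (v u) - bis_log_du u (- v u)) / (bis_log_dv u (v u) + bis_log_dv u (- v u))) in dv.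
assert (hD : 0 < u ^ 2 + v u ^ 2 - 1) by nra.
assert (hM : 0 < median_ratio u (v u)).
{ apply Rdiv_lt_0_compat; [apply Rmult_lt_0_compat; [exact hD|apply pow_lt; lra]|].
  repeat apply Rmult_lt_0_compat; lra. }
exists (median_ratio u (v u) * (median_log_du u (v u) + median_log_dv u (v u) * dvu)); split.
- apply Rmult_lt_0_compat; [exact hM|].
  assert (J := jacobian_gt0 u (v u) hu h).
  assert (L1 : 0 < bis_log_dv u (v u)) by (apply bis_log_dv_gt0; lra).
  assert (L2 : 0 < bis_log_dv u (- v u)) by (apply bis_log_dv_gt0; lra).
  replace (median_log_du u (v u) + median_log_dv u (v u) * dvu)
    with ((median_log_du u (v u) * (bis_log_dv u (v u) + bis_log_dv u (- v u))
      - median_log_dv u (v u) * (bis_log_du u (v u) - bis_log_du u (- v u)))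
      / (bis_log_dv u (v u) + bis_log_dv u (- v u))) by (unfold dvu; field; lra).
  apply Rdiv_lt_0_compat; lra.
- apply is_derive_ext_loc with (fun w => median_ratio w (v w)).
  { generalize (open_gt 1 u hu); apply filter_imp; intros w hw.
    rewrite Rmax_right by lra; reflexivity. }
  clearbody dvu.
  unfold median_ratio, median_log_du, median_log_dv.
  auto_derive.
  + split; [exists dvu; exact dv|]. repeat split; try (exists dvu; exact dv).
    apply Rgt_not_eq; repeat apply Rmult_lt_0_compat; lra.
  + rewrite (is_derive_unique (fun x : R => v x) u dvu dv). field. repeat split; lra.
Qed.

Lemma median_ratio_curve_incr (p q : R) (v : R -> R) (u w : R) :
  0 < p -> 0 < q -> ratio_curve p q v -> 1 <= u -> u < w ->
  median_ratio u (v u) < median_ratio w (v w).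
Proof.
intros hp hq hv hu huw.
set (h := fun x => median_ratio (Rmax 1 x) (v x)).
assert (E : forall x, 1 <= x -> median_ratio x (v x) = h x)
  by (intros x hx; unfold h; rewrite Rmax_right; [reflexivity|exact hx]).
rewrite !E by lra.
(* The mean value point may be the endpoint [1], where no derivative of [h] has been established;
   the default [1] keeps the slope positive there. *)
destruct (MVT_gen h u w (fun x => if Rlt_dec 1 x then Derive h x else 1)) as [x [_ e]].
- rewrite Rmin_left, Rmax_right by lra; intros x hx.
  destruct (Rlt_dec 1 x) as [h1|h1]; [|lra].
  destruct (median_ratio_curve_derive p q v x hp hq hv h1) as [d [_ hd]].
  apply Derive_correct; exists d; exact hd.
- intros x _; apply (median_ratio_curve_continuous p q); assumption.
- assert (0 < (if Rlt_dec 1 x then Derive h x else 1)).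
  { destruct (Rlt_dec 1 x) as [h1|h1]; [|lra].
    destruct (median_ratio_curve_derive p q v x hp hq hv h1) as [d [hd0 hd]].
    rewrite (is_derive_unique h x d hd); exact hd0. }
  nra.
Qed.

(** A bound uniform in [v], so the ratio tends to infinity along the curve whatever [v u] does. *)
Lemma median_ratio_lower (u v : R) :
  1 <= u -> -1 < v < 1 -> (u - 1) / 2 <= median_ratio u v.
Proof.
intros hu hv; unfold median_ratio.
apply -> Rle_div_r; [|repeat apply Rmult_lt_0_compat; lra].
assert (h1 : (u + v) * (1 + v) <= (u + 2 + v) ^ 2 * 1) by nra.
assert (h2 : (u - 1) / 2 * (1 + u) <= u ^ 2 + v ^ 2 - 1) by nra.
assert (h3 : 0 <= (u - 1) / 2 * (1 + u)) by nra.
assert (h4 : 0 <= (u + v) * (1 + v)) by (apply Rmult_le_pos; lra).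
replace ((u - 1) / 2 * ((u + v) * (1 + v) * (1 + u)))
  with ((u - 1) / 2 * (1 + u) * ((u + v) * (1 + v))) by ring.
rewrite !Rmult_1_r in *.
apply Rmult_le_compat; assumption.
Qed.

Lemma median_ratio_curve_onto (p q : R) (v : R -> R) (y : R) :
  0 < p -> 0 < q -> ratio_curve p q v -> median_ratio 1 (v 1) < y ->
  exists u, 1 < u /\ median_ratio u (v u) = y.
Proof.
intros hp hq hv hy.
(* Chosen so that [(U - 1) / 2 = Rabs y + 1 / 2] exceeds [y]. *)
set (U := 2 * Rabs y + 2).
assert (hU : 1 < U) by (unfold U; assert (h := Rabs_pos y); lra).
assert (yU : y < median_ratio U (v U)).
{ apply Rlt_le_trans with ((U - 1) / 2).
  - unfold U; assert (h := Rle_abs y); lra.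
  - apply median_ratio_lower; [lra|apply hv]. }
destruct (IVT (fun x => median_ratio (Rmax 1 x) (v x) - y) 1 U) as [u [hu eu]].
- intros x; apply continuity_pt_minus; [|apply continuity_pt_const; red; reflexivity].
  apply (median_ratio_curve_continuous p q); assumption.
- exact hU.
- rewrite Rmax_right by lra; lra.
- rewrite Rmax_right by lra; lra.
- rewrite Rmax_right in eu by lra.
  exists u; split; [|lra].
  destruct (proj1 hu) as [h|h]; [exact h|subst u; lra].
Qed.

(** * Triangles in the coordinates u, v *)

(** Substitute [a = c (u + v) / 2] and [b = c (u - v) / 2]. The triangle inequalities become the
    bounds on [u] and [v], and both bisector equations acquire the common factor [c^2 / 4]. *)
Lemma triangle_coordinates (T : plane_triangle) :
  let a := pdist (vB T) (vC T) in
  let b := pdist (vC T) (vA T) in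
  let c := pdist (vA T) (vB T) in
  let u := (a + b) / c in
  let v := (a - b) / c in
  0 < c /\ 1 < u /\ -1 < v < 1 /\
  (forall l, has_l_a T l <->
     0 <= l /\ l ^ 2 * (u + 2 - v) ^ 2 = 2 * c ^ 2 * (1 + u) * ((u - v) * (1 - v))) /\
  (forall l, has_l_b T l <->
     0 <= l /\ l ^ 2 * (u + 2 + v) ^ 2 = 2 * c ^ 2 * (1 + u) * ((u + v) * (1 + v))) /\
  4 * m_c T ^ 2 = c ^ 2 * (u ^ 2 + v ^ 2 - 1).
Proof.
intros a b c u v.
assert (nA := nondegenerate T).
assert (nB := noncollinear_rotate _ _ _ nA).
assert (nC := noncollinear_rotate _ _ _ nB).
destruct (noncollinear_gt0 _ _ _ nA) as (hc & _ & _).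
assert (tA := triangle_ineq_strict _ _ _ nA).
assert (tB := triangle_ineq_strict _ _ _ nB).
assert (tC := triangle_ineq_strict _ _ _ nC).
assert (eA := fun l => bisector_lengthP _ _ _ l nA).
assert (eB := fun l => bisector_lengthP _ _ _ l nB).
assert (eM := m_c_sqr T).
rewrite (pdist_sym (vA T) (vC T)) in *.
rewrite (pdist_sym (vB T) (vA T)) in *.
rewrite (pdist_sym (vC T) (vB T)) in *.
simpl in eA, eB.
unfold has_l_a, has_l_b.
fold a b c in hc, tA, tB, tC, eM.
assert (ha : a = c * (u + v) / 2) by (unfold u, v; field; lra).
assert (hb : b = c * (u - v) / 2) by (unfold u, v; field; lra).
assert (hu : 1 < u) by (apply (Rmult_lt_reg_l c); lra).
assert (hv : -1 < v < 1) by (split; apply (Rmult_lt_reg_l c); lra).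
assert (hc2 : 0 < c ^ 2) by (apply pow_lt; exact hc).
split; [exact hc|]. split; [exact hu|]. split; [exact hv|].
split; [|split].
- intros l; rewrite eA; split; intros [hl e]; (split; [exact hl|]).
  + change (l ^ 2 * (c + b) ^ 2 = c * b * ((c + b) ^ 2 - a ^ 2)) in e.
    apply (Rmult_eq_reg_l (c ^ 2 / 4)); [|lra].
    transitivity (l ^ 2 * (c + b) ^ 2); [rewrite hb; field|].
    rewrite e, ha, hb; field.
  + change (l ^ 2 * (c + b) ^ 2 = c * b * ((c + b) ^ 2 - a ^ 2)).
    apply (f_equal (Rmult (c ^ 2 / 4))) in e.
    transitivity (c ^ 2 / 4 * (l ^ 2 * (u + 2 - v) ^ 2)); [rewrite hb; field|].
    rewrite e, ha, hb; field.
- intros l; rewrite eB; split; intros [hl e]; (split; [exact hl|]).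
  + change (l ^ 2 * (a + c) ^ 2 = a * c * ((a + c) ^ 2 - b ^ 2)) in e.
    apply (Rmult_eq_reg_l (c ^ 2 / 4)); [|lra].
    transitivity (l ^ 2 * (a + c) ^ 2); [rewrite ha; field|].
    rewrite e, ha, hb; field.
  + change (l ^ 2 * (a + c) ^ 2 = a * c * ((a + c) ^ 2 - b ^ 2)).
    apply (f_equal (Rmult (c ^ 2 / 4))) in e.
    transitivity (c ^ 2 / 4 * (l ^ 2 * (u + 2 + v) ^ 2)); [rewrite ha; field|].
    rewrite e, ha, hb; field.
- rewrite eM, ha, hb; field.
Qed.

(** Multiplied out, the coordinates determine the three sides by linear equations. *)
Definition has_shape (T : plane_triangle) (c u v : R) : Prop :=
  pdist (vA T) (vB T) = c /\
  pdist (vB T) (vC T) + pdist (vC T) (vA T) = c * u /\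
  pdist (vB T) (vC T) - pdist (vC T) (vA T) = c * v.

Lemma shape_congruent (T T' : plane_triangle) (c u v : R) :
  has_shape T c u v -> has_shape T' c u v -> congruent T T'.
Proof.
intros (e1 & e2 & e3) (e1' & e2' & e3').
apply congruent_sss; lra.
Qed.

Lemma shape_exists (c u v : R) :
  0 < c -> 1 < u -> -1 < v < 1 -> exists T, has_shape T c u v.
Proof.
intros hc hu hv.
destruct (triangle_of_sides (c * (u + v) / 2) (c * (u - v) / 2) c) as (T & e1 & e2 & e3);
  try nra.
exists T; unfold has_shape; rewrite e1, e2, e3; repeat split; field.
Qed.

(* The squared side [c ^ 2] is expressed through [l1] alone; the condition on [l2] then becomes
   the vanishing of [ratio_defect]. *)
Lemma shape_dataP (T : plane_triangle) (c u v l1 l2 x : R) :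
  0 < c -> 1 < u -> -1 < v < 1 -> 0 < l1 -> 0 < l2 -> 0 <= x -> has_shape T c u v ->
  has_l_a T l2 /\ has_l_b T l1 /\ m_c T = x <->
  c ^ 2 = l1 ^ 2 * (u + 2 + v) ^ 2 / (2 * (1 + u) * ((u + v) * (1 + v))) /\
  ratio_defect (l1 ^ 2) (l2 ^ 2) u v = 0 /\
  8 * x ^ 2 = l1 ^ 2 * median_ratio u v.
Proof.
intros hc hu hv hl1 hl2 hx (ec & eu & ev).
assert (D := triangle_coordinates T); cbv zeta in D.
rewrite ec, eu, ev in D.
replace (c * u / c) with u in D by (field; lra).
replace (c * v / c) with v in D by (field; lra).
destruct D as (_ & _ & _ & eA & eB & eM).
assert (hw : 0 < 2 * (1 + u) * ((u + v) * (1 + v))).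
{ repeat apply Rmult_lt_0_compat; lra. }
set (w := 2 * (1 + u) * ((u + v) * (1 + v))) in *.
assert (E1 : c ^ 2 = l1 ^ 2 * (u + 2 + v) ^ 2 / w <->
   l1 ^ 2 * (u + 2 + v) ^ 2 = 2 * c ^ 2 * (1 + u) * ((u + v) * (1 + v))).
{ replace (2 * c ^ 2 * (1 + u) * ((u + v) * (1 + v))) with (c ^ 2 * w) by (unfold w; ring).
  split; intros e; [rewrite e; field; lra|].
  rewrite e; field; lra. }
assert (E2 : l1 ^ 2 * (u + 2 + v) ^ 2 = 2 * c ^ 2 * (1 + u) * ((u + v) * (1 + v)) ->
   ratio_defect (l1 ^ 2) (l2 ^ 2) u v = 0 <->
   l2 ^ 2 * (u + 2 - v) ^ 2 = 2 * c ^ 2 * (1 + u) * ((u - v) * (1 - v))).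
{ intros e.
  assert (h : ratio_defect (l1 ^ 2) (l2 ^ 2) u v = (u + v) * (1 + v) *
    (l2 ^ 2 * (u + 2 - v) ^ 2 - 2 * c ^ 2 * (1 + u) * ((u - v) * (1 - v)))).
  { transitivity (l2 ^ 2 * bis u v - (l1 ^ 2 * (u + 2 + v) ^ 2) * ((u - v) * (1 - v))).
    - unfold ratio_defect, bis; ring.
    - rewrite e; unfold bis; ring. }
  assert (0 < (u + v) * (1 + v)) by (apply Rmult_lt_0_compat; lra).
  rewrite h; split; intros h'.
  - apply Rmult_integral in h'; destruct h' as [h'|h']; lra.
  - rewrite h'; ring. }
assert (E3 : c ^ 2 = l1 ^ 2 * (u + 2 + v) ^ 2 / w ->
   l1 ^ 2 * median_ratio u v = 2 * (c ^ 2 * (u ^ 2 + v ^ 2 - 1))).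
{ intros e; rewrite e; unfold median_ratio, w; field; lra. }
split.
- intros (ha & hb & hm).
  apply eA in ha; apply eB in hb.
  destruct hb as [_ hb]; destruct ha as [_ ha].
  rewrite hm in eM.
  split; [apply E1, hb|]. split; [apply E2; assumption|].
  rewrite E3 by (apply E1, hb). lra.
- intros (h1 & h2 & h3).
  rewrite E3 in h3 by exact h1.
  apply E1 in h1.
  split; [apply eA; split; [lra|apply E2; assumption]|].
  split; [apply eB; split; [lra|exact h1]|].
  apply pow2_inj; [apply pdist_ge0|exact hx|lra].
Qed.

(* [u = 1] is the degenerate triangle with sides [a_star], [b_star], [c_star]. *)
Lemma degenerate_shape (l1 l2 : R) (hl2 : 0 < l2) (hl21 : l2 <= l1) :
  let c := / 2 * (l1 + l2 + sqrt (l1 ^ 2 + l2 ^ 2 - l1 * l2)) in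
  let m := / 2 * (c / (2 * c / l1 - 1) - c / (2 * c / l2 - 1)) in
  0 <= m /\
  exists v, -1 < v < 1 /\ ratio_defect (l1 ^ 2) (l2 ^ 2) 1 v = 0 /\
    8 * m ^ 2 = l1 ^ 2 * median_ratio 1 v.
Proof.
set (d := sqrt (l1 ^ 2 + l2 ^ 2 - l1 * l2)); intros c m.
assert (ed : d ^ 2 = l1 ^ 2 + l2 ^ 2 - l1 * l2) by (apply pow2_sqrt; nra).
assert (hd : 0 <= d) by apply sqrt_pos.
assert (d1 : l1 - l2 < d) by nra.
(* After squaring this is [l2 <= l1]; it leads to [0 <= v] and hence [0 <= m]. *)
assert (d2 : d <= 2 * l1 - l2) by nra.
assert (hc1 : l1 < c) by (unfold c; lra).
assert (hc2 : 2 * c <= 3 * l1) by (unfold c; lra).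
(* [c] is the larger root of this quadratic, which results from eliminating [v] between [h1] and
   [h2] below. *)
assert (ec : 4 * c ^ 2 - 4 * c * (l1 + l2) + 3 * (l1 * l2) = 0).
{ replace (4 * c ^ 2) with ((l1 + l2) ^ 2 + 2 * (l1 + l2) * d + d ^ 2) by (unfold c; field).
  rewrite ed; unfold c; field. }
clearbody c.
(* At [u = 1] the equation for [l_b] is a perfect square; its root [h1] is linear in [v] and is
   solved here. [h2] is the counterpart for [l_a]. *)
set (v := (3 * l1 - 2 * c) / (2 * c - l1)).
assert (h1 : l1 * (3 + v) = 2 * c * (1 + v)) by (unfold v; field; lra).
assert (h2 : l2 * (3 - v) = 2 * c * (1 - v)).
{ apply (Rmult_eq_reg_r (2 * c - l1)); [|lra].
  replace (l2 * (3 - v) * (2 * c - l1)) with (8 * (l2 * c) - 6 * (l1 * l2))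
    by (unfold v; field; lra).
  replace (2 * c * (1 - v) * (2 * c - l1)) with (8 * (c ^ 2) - 8 * (c * l1))
    by (unfold v; field; lra).
  lra. }
assert (hv0 : 0 <= v) by (apply Rdiv_le_0_compat; lra).
assert (hv1 : v < 1).
{ unfold v; apply <- Rlt_div_l; lra. }
assert (em : m = c * v / 2).
{ assert (e1 : c / (2 * c / l1 - 1) = c * (1 + v) / 2) by (unfold v; field; lra).
  assert (e2 : c / (2 * c / l2 - 1) = c * (1 - v) / 2).
  { apply (Rmult_eq_reg_r (2 * c / l2 - 1)).
    - replace (2 * c / l2) with ((3 - v) / (1 - v)).
      + field; lra.
      + apply (Rmult_eq_reg_r (l2 * (1 - v))); [|apply Rmult_integral_contrapositive; lra].
        transitivity (l2 * (3 - v)); [field; lra|]. rewrite h2; field; lra.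
    - assert (1 < 2 * c / l2) by (apply -> Rlt_div_r; lra). lra. }
  unfold m; rewrite e1, e2; field. }
split; [rewrite em; nra|].
exists v; split; [lra|split].
- unfold ratio_defect, bis.
  replace (l2 ^ 2 * ((1 + v) * (1 + v) * (1 + 2 - v) ^ 2))
    with ((1 + v) ^ 2 * (l2 * (3 - v)) ^ 2) by ring.
  replace (l1 ^ 2 * ((1 + - v) * (1 + - v) * (1 + 2 - - v) ^ 2))
    with ((1 - v) ^ 2 * (l1 * (3 + v)) ^ 2) by ring.
  rewrite h1, h2; ring.
- replace (l1 ^ 2 * median_ratio 1 v) with ((l1 * (3 + v)) ^ 2 * v ^ 2 / (2 * (1 + v) ^ 2))
    by (unfold median_ratio; field; lra).
  rewrite h1, em; field; lra.
Qed.

Theorem mainTheorem12 (l1 l2 : R) (hl2 : 0 < l2) (hl21 : l2 <= l1) :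
  let c_star := / 2 * (l1 + l2 + sqrt (l1 ^ 2 + l2 ^ 2 - l1 * l2)) in
  let a_star := c_star / (2 * c_star / l1 - 1) in
  let b_star := c_star / (2 * c_star / l2 - 1) in
  let m_star := / 2 * (a_star - b_star) in
  (forall x : R, m_star < x ->
     exists T : plane_triangle,
       (has_l_a T l2 /\ has_l_b T l1 /\ m_c T = x) /\
       (forall T' : plane_triangle,
          has_l_a T' l2 /\ has_l_b T' l1 /\ m_c T' = x -> congruent T T')) /\
  (forall x : R, x <= m_star ->
     ~ (exists T : plane_triangle, has_l_a T l2 /\ has_l_b T l1 /\ m_c T = x)).
Proof.
intros c_star a_star b_star m_star.
destruct (degenerate_shape l1 l2 hl2 hl21) as (hm & v0 & hv0 & e0 & em).
fold c_star in hm, em; fold a_star b_star in hm, em; fold m_star in hm, em.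
clearbody m_star; clear a_star b_star c_star.
assert (hl1 : 0 < l1) by lra.
assert (hp : 0 < l1 ^ 2) by (apply pow_lt; exact hl1).
assert (hq : 0 < l2 ^ 2) by (apply pow_lt; exact hl2).
destruct (ratio_curve_exists _ _ hp hq) as [v hv].
assert (rootE : forall u, 1 <= u -> ratio_defect (l1 ^ 2) (l2 ^ 2) u (v u) = 0).
{ intros u hu; destruct (hv u) as [_ e]; rewrite Rmax_right in e; assumption. }
(* The degenerate shape is the starting point of the curve, so [m_star] gives the value of
   [median_ratio] there. *)
assert (ev0 : v0 = v 1).
{ apply (ratio_defect_root_unique (l1 ^ 2) (l2 ^ 2) 1); try assumption; try lra.
  - apply hv.
  - apply rootE; lra. }
rewrite ev0 in em; clear v0 hv0 e0 ev0.
(* Every triangle with the given data lies on the curve, by uniqueness of the root in [v]. *)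
assert (shapeT : forall T x, has_l_a T l2 /\ has_l_b T l1 /\ m_c T = x ->
  exists c u, 0 < c /\ 1 < u /\ has_shape T c u (v u) /\ 8 * x ^ 2 = l1 ^ 2 * median_ratio u (v u) /\
   c ^ 2 = l1 ^ 2 * (u + 2 + v u) ^ 2 / (2 * (1 + u) * ((u + v u) * (1 + v u)))).
{ intros T x hT.
  assert (hx : 0 <= x) by (destruct hT as (_ & _ & <-); apply pdist_ge0).
  assert (D := triangle_coordinates T); cbv zeta in D.
  destruct D as (hc & hu & hw & _).
  set (a := pdist (vB T) (vC T)) in *. set (b := pdist (vC T) (vA T)) in *.
  set (c := pdist (vA T) (vB T)) in *.
  set (u := (a + b) / c) in *. set (w := (a - b) / c) in *.
  assert (sh : has_shape T c u w).
  { unfold has_shape; fold a b c; unfold u, w; repeat split; field; lra. }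
  apply (shape_dataP T c u w) in hT; try assumption.
  destruct hT as (h1 & h2 & h3).
  assert (ew : w = v u).
  { apply (ratio_defect_root_unique (l1 ^ 2) (l2 ^ 2) u); try assumption; try lra.
    - apply hv.
    - apply rootE; lra. }
  rewrite ew in sh, h1, h3.
  exists c, u; auto. }
split.
- intros x hx.
  destruct (median_ratio_curve_onto (l1 ^ 2) (l2 ^ 2) v (8 * x ^ 2 / l1 ^ 2)) as (u & hu & eu);
    try assumption.
  { apply -> Rlt_div_r; [|exact hp]. nra. }
  destruct (hv u) as [hvu _].
  assert (ex : 8 * x ^ 2 = l1 ^ 2 * median_ratio u (v u)) by (rewrite eu; field; lra).
  (* The value that the condition on [l_b] forces on [c^2]. *)
  set (c2 := l1 ^ 2 * (u + 2 + v u) ^ 2 / (2 * (1 + u) * ((u + v u) * (1 + v u)))).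
  assert (hc2 : 0 < c2).
  { apply Rdiv_lt_0_compat; [apply Rmult_lt_0_compat; [exact hp|apply pow_lt; lra]|].
    repeat apply Rmult_lt_0_compat; lra. }
  assert (hc : 0 < sqrt c2) by (apply sqrt_lt_R0; exact hc2).
  assert (ec : sqrt c2 ^ 2 = c2) by (apply pow2_sqrt; lra).
  destruct (shape_exists (sqrt c2) u (v u)) as [T sh]; try assumption.
  exists T; split.
  + apply (shape_dataP T (sqrt c2) u (v u)); try assumption; try lra.
    split; [exact ec|split; [apply rootE; lra|exact ex]].
  + intros T' hT'.
    destruct (shapeT T' x hT') as (c' & u' & hc' & hu' & sh' & ex' & ec').
    assert (eM : median_ratio u (v u) = median_ratio u' (v u'))
      by (apply (Rmult_eq_reg_l (l1 ^ 2)); lra).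
    (* Equal medians give equal ratios, and strict growth along the curve makes [u] unique. *)
    assert (e : u = u').
    { destruct (Rtotal_order u u') as [h|[h|h]]; [|exact h|];
      apply (median_ratio_curve_incr (l1 ^ 2) (l2 ^ 2) v) in h; try assumption; lra. }
    subst u'.
    assert (c' = sqrt c2) by (apply pow2_inj; [lra|lra|rewrite ec; exact ec']).
    subst c'.
    apply (shape_congruent T T' (sqrt c2) u (v u)); assumption.
- intros x hx [T hT].
  assert (hx0 : 0 <= x) by (destruct hT as (_ & _ & <-); apply pdist_ge0).
  destruct (shapeT T x hT) as (c & u & _ & hu & _ & ex & _).
  (* A genuine triangle has [u > 1], so its median strictly exceeds the degenerate value. *)
  assert (lt : median_ratio 1 (v 1) < median_ratio u (v u))
    by (apply (median_ratio_curve_incr (l1 ^ 2) (l2 ^ 2) v); try assumption; lra).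
  assert (8 * m_star ^ 2 < 8 * x ^ 2)
    by (rewrite em, ex; apply Rmult_lt_compat_l; assumption).
  nra.
Qed.
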